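(* Let $k>2$ be an integer and let $R_k=\{n : H(n)=k,\ 4\cdot 3^{k-2}<n\le 2\cdot 3^{k-1}\}$. Then $R_k$ consists exactly of the numbers of the form $2\cdot 3^{k-a}p$, where $p\in\widehat{P}$, $a=H(p)$ and $a\le k$.
   Context: Let $\varphi$ be Euler's totient function. The height function $H$ on positive integers is defined by $H(1)=0$ and $H(n)=H(\varphi(n))+1$ for $n\ge 2$. Let $\widehat{P}$ be the set of primes $p$ such that $p=2\cdot 3^{j-2}+1$ for some integer $j\ge 2$. *)

(* Defs.v *)
From mathcomp Require Import all_boot.

Set Implicit Arguments.
Unset Strict Implicit.
Unset Printing Implicit Defensive.

(* [totient n < n] for [n >= 2], so [n] steps of fuel suffice to evaluate the
   recursion at [n]; see [height1] and [heightE]. *)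
Fixpoint height_rec (fuel n : nat) : nat :=
  if fuel is f.+1 then
    if n <= 1 then 0 else (height_rec f (totient n)).+1
  else 0.

(* Junk value: [height 0 = 0]. *)
Definition height (n : nat) : nat := height_rec n n.

Lemma totient_lt n : 1 < n -> totient n < n.
Proof.
case: n => [|[|n]] // _.
rewrite totient_count_coprime big_nat_recl // /coprime gcdn0 add0n ltnS.
rewrite -[leqRHS]muln1 -[n.+1 in leqRHS]subn0 -sum_nat_const_nat.
by apply: leq_sum => i _; case: (_ == _).
Qed.

Lemma height_rec_fuel f g n : n <= f -> n <= g ->
  height_rec f n = height_rec g n.
Proof.
elim: f g n => [|f IH] [|g] n /=.
- by [].
- by rewrite leqn0 => /eqP->.
- by move=> _; rewrite leqn0 => /eqP->.
move=> nf ng; case: leqP => // n1.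
have tn := totient_lt n1.
by rewrite (IH g) // -ltnS; apply: leq_trans tn _.
Qed.

Lemma height1 : height 1 = 0.
Proof. by []. Qed.

Lemma heightE n : 1 < n -> height n = (height (totient n)).+1.
Proof.
case: n => [|n] // n1; rewrite {1}/height /= leqNgt n1 /=.
by rewrite (@height_rec_fuel n (totient n.+1)) // -ltnS totient_lt.
Qed.

Definition Phat (p : nat) : Prop :=
  prime p /\ exists j : nat, 2 <= j /\ p = 2 * 3 ^ (j - 2) + 1.

Definition Rset (k n : nat) : Prop :=
  height n = k /\ 4 * 3 ^ (k - 2) < n <= 2 * 3 ^ (k - 1).

(* Main.v *)
Require Import Defs.
From mathcomp Require Import all_boot.
From mathcomp Require Import zify.

(** Let [shapiro n] be the height of [n], diminished by 1 when [n] is odd.  As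
    [shapiro n = shapiro (totient n) + [n even]], the function [shapiro] is completely additive
    (Shapiro).  Since [p - 1] is even for an odd prime [p], induction gives
    [n <= 3 ^ shapiro n].  As [shapiro 2 = 1], an element [n] of R_k must be [2 m] with [m]
    odd and [2 * 3 ^ shapiro m < 3 * m].  Comparing the multiplicative ratio
    [m / 3 ^ shapiro m <= 1] with 2/3 prime by prime, every prime factor of [m] is of the
    form [2 * 3 ^ e + 1], and at most one of them differs from 3, because
    [(7/9)^2 < 2/3]. *)

Lemma prime_mul_ind (P : nat -> Prop) :
    P 1 -> (forall p m, prime p -> 0 < m -> P m -> P (p * m)) ->
  forall n, 0 < n -> P n.
Proof.
move=> P1 PM; elim/ltn_ind => n IH n0.
have [n1|n1] := leqP n 1; first by have -> : n = 1 by lia.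
have pr_p := pdiv_prime n1.
have /dvdnP [m En] := pdiv_dvd n.
have m0 : 0 < m by lia.
have p1 := prime_gt1 pr_p.
by rewrite En mulnC; apply: PM => //; apply: IH => //; nia.
Qed.

Lemma totientM_dvd p m : prime p -> 0 < m -> p %| m ->
  totient (p * m) = p * totient m.
Proof.
move=> pr_p m0 pm.
have l0 : 0 < logn p m by rewrite logn_gt0 mem_primes pr_p m0.
have cp e : coprime (p ^ e) m`_p^'.
  by rewrite coprimeXl // -(coprime_pexpl _ _ l0) -p_part coprime_partC.
rewrite -(partnC p m0) p_part mulnA -expnS.
rewrite !totient_coprime ?cp // !totient_pfactor //=.
by case: (logn p m) l0 => // e _ /=; rewrite expnS; lia.
Qed.

Lemma totientM_ndvd p m : prime p -> ~~ (p %| m) ->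
  totient (p * m) = p.-1 * totient m.
Proof.
by move=> pr_p pm; rewrite totient_coprime ?prime_coprime // totient_prime.
Qed.

Lemma odd_totient_le2 n : 0 < n -> odd (totient n) -> n <= 2.
Proof.
move: n; apply: prime_mul_ind => // p m pr_p m0 IH.
have p1 := prime_gt1 pr_p.
have [pm|pm] := boolP (p %| m).
  rewrite totientM_dvd // oddM => /andP [po /IH m2].
  by have := dvdn_leq m0 pm; lia.
rewrite totientM_ndvd // oddM => /andP [po /IH m2].
have [p2|] := even_prime pr_p; last by lia.
by move: pm; rewrite p2; lia.
Qed.

(** Truncated subtraction gives [shapiro 1 = 0], as additivity requires. *)
Definition shapiro (n : nat) : nat := height n - odd n.

(** For [n > 2] the totient is even, so only the parity of [n] itself corrects the height. *)
Lemma shapiro_totient n : 0 < n -> shapiro n = shapiro (totient n) + ~~ odd n.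
Proof.
move=> n0; have [n2|n2] := leqP n 2.
  by move: n0 n2; case: n => [|[|[|]]].
have ev : odd (totient n) = false.
  by apply/negP => /(odd_totient_le2 _ n0); lia.
by rewrite /shapiro ev heightE; [case: odd; lia | exact: ltnW].
Qed.

Lemma shapiro_prime p : prime p -> shapiro p = shapiro p.-1 + ~~ odd p.
Proof. by move=> pr_p; rewrite shapiro_totient ?prime_gt0 // totient_prime. Qed.

Lemma shapiroM a b : 0 < a -> 0 < b -> shapiro (a * b) = shapiro a + shapiro b.
Proof.
have [N] := ubnP (a * b); elim: N a b => // N IH a b ab.
(* First the case of a prime factor: the totient of [p * m] is [p * totient m] or
   [p.-1 * totient m], a smaller product in both cases, to which [IH] applies. *)
have DpM p m : prime p -> 0 < m -> p * m < N.+1 -> shapiro (p * m) = shapiro p + shapiro m.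
  move=> pr_p m0 pmN; have p1 := prime_gt1 pr_p.
  rewrite shapiro_totient ?muln_gt0 ?m0 ?prime_gt0 //.
  have t0 : 0 < totient m by rewrite totient_gt0.
  rewrite oddM [shapiro m](shapiro_totient _ m0).
  have [pm|pm] := boolP (p %| m).
    have tm : totient m < m.
      by apply: totient_lt; have := dvdn_leq m0 pm; lia.
    have ptN : p * totient m < N by nia.
    rewrite totientM_dvd // IH ?(prime_gt0 pr_p) //.
    have [p2|->] := even_prime pr_p; last by lia.
    by move: pm; rewrite p2; lia.
  have tm : totient m <= m.
    have [m1|m1] := ltnP 1 m; first by apply: ltnW; apply: totient_lt.
    by have -> : m = 1 by lia.
  have ptN : p.-1 * totient m < N by nia.
  have p'0 : 0 < p.-1 by lia.
  rewrite totientM_ndvd // IH // (shapiro_prime _ pr_p).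
  have [p2|->] := even_prime pr_p; last by lia.
  by move: pm; rewrite p2; lia.
move=> a0 b0; move: a a0 ab.
apply: prime_mul_ind => [|p m pr_p m0 IHm]; first by rewrite mul1n.
move=> pmb; have p1 := prime_gt1 pr_p.
have mbN : m * b < N.+1 by nia.
have mb0 : 0 < m * b by rewrite muln_gt0 m0.
have pmN : p * m < N.+1 by nia.
by rewrite -mulnA (DpM _ _ pr_p mb0) ?mulnA // (DpM _ _ pr_p m0) // IHm // addnA.
Qed.

Lemma shapiro_exp3 b : shapiro (3 ^ b) = b.
Proof.
elim: b => // b IH; rewrite expnS shapiroM ?expn_gt0 // IH.
by rewrite (_ : shapiro 3 = 1).
Qed.

Lemma odd_prime_half p : prime p -> odd p ->
  exists q, [/\ 0 < q, p = 2 * q + 1 & shapiro p = (shapiro q).+1].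
Proof.
move=> pr_p po; have p1 := prime_gt1 pr_p.
exists p./2; have q0 : 0 < p./2 by lia.
split=> //; first by lia.
rewrite shapiro_prime // po addn0 (_ : p.-1 = 2 * p./2); last by lia.
by rewrite shapiroM.
Qed.

(** By additivity it suffices to bound each prime factor: an odd prime [p = 2 * q + 1] is at most
    [3 * q], and [shapiro p] exceeds [shapiro q] by 1. *)
Lemma leq_exp3_shapiro n : 0 < n -> n <= 3 ^ shapiro n.
Proof.
elim/ltn_ind: n => n IH n0.
have [n1|n1] := leqP n 1; first by have -> : n = 1 by lia.
have /pdivP [p pr_p pn] := n1.
have p1 := prime_gt1 pr_p.
have pn' := dvdn_leq n0 pn.
have /dvdnP [m En] := pn.
have m0 : 0 < m by lia.
have Hm : m <= 3 ^ shapiro m by apply: IH => //; nia.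
rewrite En shapiroM ?(prime_gt0 pr_p) // expnD leq_mul //.
have [->//|po] := even_prime pr_p.
have [q [q0 Ep ->]] := odd_prime_half _ pr_p po.
have Hq : q <= 3 ^ shapiro q by apply: IH => //; lia.
by rewrite expnS; lia.
Qed.

(** With [p = 2 * q + 1], the hypothesis forces [3 ^ shapiro q <= q]; the general bound is the
    reverse inequality, so [q] is a power of 3. *)
Lemma large_prime_form p : prime p -> odd p -> 2 * 3 ^ shapiro p < 3 * p ->
  exists e, p = 2 * 3 ^ e + 1 /\ shapiro p = e.+1.
Proof.
move=> pr_p po; have [q [q0 Ep ->]] := odd_prime_half _ pr_p po.
rewrite expnS => large.
by exists (shapiro q); split=> //; have := leq_exp3_shapiro _ q0; lia.
Qed.

(** The ratio of [b] is at most 1, so dropping [b] cannot lower the ratio of the product. *)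
Lemma large_factor a b : 0 < a -> 0 < b -> 2 * 3 ^ shapiro (a * b) < 3 * (a * b) ->
  2 * 3 ^ shapiro a < 3 * a.
Proof.
move=> a0 b0; rewrite shapiroM // expnD => large.
have := leq_exp3_shapiro _ b0; have : 0 < 3 ^ shapiro b by rewrite expn_gt0.
by nia.
Qed.

(** A prime [2 * 3 ^ e + 1] has ratio [2/3 + 1/3 ^ e.+1], which is at most 7/9 once [e > 0]. *)
Lemma large_at_most_one p q : prime p -> odd p -> p != 3 ->
    prime q -> odd q -> q != 3 -> 2 * 3 ^ shapiro (p * q) < 3 * (p * q) -> False.
Proof.
move=> pr_p po p3 pr_q qo q3 large.
have large_p : 2 * 3 ^ shapiro p < 3 * p.
  by apply: large_factor _ _ _ _ large; exact: prime_gt0.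
have large_q : 2 * 3 ^ shapiro q < 3 * q.
  by rewrite (mulnC p) in large; apply: large_factor _ _ _ _ large; exact: prime_gt0.
have [[|e] [Ep De]] := large_prime_form _ pr_p po large_p.
  by move: p3; rewrite Ep.
have [[|f] [Eq Df]] := large_prime_form _ pr_q qo large_q.
  by move: q3; rewrite Eq.
move: large; rewrite shapiroM ?prime_gt0 // expnD De Df Ep Eq !expnS.
have : 0 < 3 ^ e by rewrite expn_gt0.
have : 0 < 3 ^ f by rewrite expn_gt0.
by nia.
Qed.

Lemma pow3_or_prime_factor m : 0 < m ->
  (exists b, m = 3 ^ b) \/ exists p, [/\ prime p, p != 3 & p %| m].
Proof.
move: m; apply: prime_mul_ind => [|p m pr_p m0 IH]; first by left; exists 0.
have [->|p3] := eqVneq p 3; last by right; exists p; rewrite dvdn_mulr.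
case: IH => [[b ->]|[q [pr_q q3 qm]]]; first by left; exists b.+1; rewrite expnS.
by right; exists q; rewrite dvdn_mull.
Qed.

Lemma large_odd_form m : odd m -> 1 < m -> 2 * 3 ^ shapiro m < 3 * m ->
  exists p b, [/\ prime p, odd p, 2 * 3 ^ shapiro p < 3 * p & m = 3 ^ b * p].
Proof.
move=> mo m1 large; have m0 : 0 < m by lia.
case: (pow3_or_prime_factor _ m0) => [[[|b] Em]|[p [pr_p p3 /dvdnP [m' Em]]]].
- by move: m1; rewrite Em.
(* For a power of 3, the distinguished prime is 3 itself. *)
- by exists 3, b; rewrite Em expnSr.
have m'0 : 0 < m' by lia.
have p0 := prime_gt0 pr_p.
move: mo; rewrite Em oddM => /andP [m'o po].
have large_p : 2 * 3 ^ shapiro p < 3 * p.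
  by apply: (large_factor _ _ p0 m'0); rewrite (mulnC p) -Em.
case: (pow3_or_prime_factor _ m'0) => [[b Eb]|[q [pr_q q3 /dvdnP [r Er]]]].
  by exists p, b; rewrite -Eb.
have qo : odd q by move: m'o; rewrite Er oddM => /andP [].
have r0 : 0 < r by lia.
exfalso; apply: (large_at_most_one p q) => //.
apply: (large_factor _ r) => //; first by rewrite muln_gt0 p0 prime_gt0.
by rewrite (_ : p * q * r = m) // Em Er; lia.
Qed.

Lemma height_prime_form p e : prime p -> p = 2 * 3 ^ e + 1 ->
  shapiro p = e.+1 /\ height p = e.+2.
Proof.
move=> pr_p Ep; have po : odd p by rewrite Ep; lia.
have Dp : shapiro p = e.+1.
  rewrite shapiro_prime // po addn0 Ep addn1 /= shapiroM ?expn_gt0 // shapiro_exp3.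
  by rewrite (_ : shapiro 2 = 1).
by split=> //; move: Dp; rewrite /shapiro po; lia.
Qed.

Lemma shapiro_2pow3M b p : 0 < p -> shapiro (2 * 3 ^ b * p) = (b + shapiro p).+1.
Proof.
by move=> p0; rewrite !shapiroM ?muln_gt0 ?expn_gt0 // shapiro_exp3 (_ : shapiro 2 = 1).
Qed.

Lemma Rset_twice_odd k n : 2 < k -> Rset k n ->
  exists m, [/\ n = 2 * m, odd m, 1 < m, shapiro n = k & 2 * 3 ^ shapiro m < 3 * m].
Proof.
case: k => [|[|k]] // k0 [Hn /andP [lo _]].
rewrite subn2 /= in lo.
have pos : 0 < 3 ^ k by rewrite expn_gt0.
have n0 : 0 < n by lia.
have ne : ~~ odd n.
  (* An odd [n] would have [shapiro n] one less than its height, hence be at most [3 * 3 ^ k], below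
     the lower bound [4 * 3 ^ k]. *)
  apply/negP => no; have := leq_exp3_shapiro _ n0.
  by rewrite /shapiro Hn no subn1 /= expnS; lia.
have Dn : shapiro n = k.+2 by rewrite /shapiro Hn (negbTE ne) subn0.
have [m Em] : exists m, n = 2 * m by exists n./2; lia.
have m0 : 0 < m by lia.
have Dm : shapiro m = k.+1.
  by move: Dn; rewrite Em shapiroM // (_ : shapiro 2 = 1) // => - [].
exists m; split=> //; last 2 first.
- by lia.
- by rewrite Dm expnS; lia.
(* If [n = 4 * r], then [r <= 3 ^ k], again contradicting the lower bound. *)
apply/negPn/negP => me; have [r Er] : exists r, m = 2 * r by exists m./2; lia.
have r0 : 0 < r by lia.
have Dr : shapiro r = k by move: Dm; rewrite Er shapiroM // (_ : shapiro 2 = 1) // => - [].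
by have := leq_exp3_shapiro _ r0; rewrite Dr; lia.
Qed.

Theorem theorem3p3 (k : nat) (hk : 2 < k) (n : nat) :
  Rset k n <->
  exists p : nat,
    [/\ Phat p, height p <= k & n = 2 * 3 ^ (k - height p) * p].
Proof.
split.
  move=> Rn; have [m [En mo m1 Dn large]] := Rset_twice_odd _ _ hk Rn.
  have [p [b [pr_p po large_p Em]]] := large_odd_form _ mo m1 large.
  have [e [Ep _]] := large_prime_form _ pr_p po large_p.
  have [Dp Hp] := height_prime_form _ _ pr_p Ep.
  (* Additivity turns [shapiro n = k] into [k = b + e + 2], that is, [b = k - height p]. *)
  move: Dn; rewrite En Em mulnA shapiro_2pow3M ?prime_gt0 // Dp => Ek.
  exists p; rewrite Hp; split; first by split=> //; exists e.+2; rewrite subn2.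
    by lia.
  by have -> : k - e.+2 = b by lia.
move=> [p [[pr_p [[|[|e]] [//= _ Ep]]] Hpk En]].
rewrite subn2 /= in Ep.
have [Dp Hp] := height_prime_form _ _ pr_p Ep.
rewrite Hp in Hpk En.
have [b Ek] : exists b, k = e + b + 2 by exists (k - e.+2); lia.
have Eb : k - e.+2 = b by lia.
rewrite Eb in En.
have Dn : shapiro n = k by rewrite En shapiro_2pow3M ?prime_gt0 // Dp; lia.
split; first by move: Dn; rewrite /shapiro En !oddM /= subn0.
have -> : k - 2 = e + b by lia.
have -> : k - 1 = (e + b).+1 by lia.
(* Here [n = 4 * 3 ^ (e + b) + 2 * 3 ^ b], whose second term is positive and at most
   [2 * 3 ^ (e + b)]. *)
rewrite En Ep expnS expnD.
have : 0 < 3 ^ e by rewrite expn_gt0.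
have : 0 < 3 ^ b by rewrite expn_gt0.
by nia.
Qed.
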